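(* There exists a constant $c > 0$ such that for all sufficiently large $k$, $\mathcal{L}(k) > k^{c \log k}$.
   Context: A congruential $2$-power modulo $k$ is a word $x_1 x_2$ over the integers with $x_1, x_2$ nonempty, $|x_1| = |x_2|$, and $\sum x_1 \equiv \sum x_2 \pmod{k}$ ($\sum x$ = sum of entries). $\mathcal{L}(k)$ is the minimum integer $n$ such that for every coloring $\chi:[1,n] \to \{0,1,\ldots,k-1\}$, the word $\chi(1)\chi(2)\cdots\chi(n)$ contains a congruential $2$-power modulo $k$ as a factor. *)

(* Defs.v *)
From HB Require Import structures.
From mathcomp Require Import all_boot all_order all_algebra zify.
From mathcomp Require Import all_classical all_reals all_analysis.
Set Implicit Arguments.
Unset Strict Implicit.
Unset Printing Implicit Defensive.
Import Order.TTheory GRing.Theory Num.Theory.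
Local Open Scope ring_scope.

Definition cong_2power (k : nat) (x : seq int) : Prop :=
  exists x1 x2 : seq int,
    [/\ x = x1 ++ x2, x1 <> [::], x2 <> [::], size x1 = size x2
      & (\sum_(a <- x1) a = \sum_(a <- x2) a %[mod k%:Z])%Z].

Definition contains_cong_2power (k : nat) (w : seq int) : Prop :=
  exists2 x : seq int, infix x w & cong_2power k x.

(* The positions 1, ..., n are indexed from 0. *)
Definition word_of (n k : nat) (chi : 'I_n -> 'I_k) : seq int :=
  [seq (nat_of_ord (chi i))%:Z | i <- enum 'I_n].

Definition unavoidable_length (k n : nat) : Prop :=
  forall chi : 'I_n -> 'I_k, contains_cong_2power k (word_of chi).

(* Color focusing: either a monochromatic three-term progression, or s
   two-term progressions of pairwise distinct colors with common focus e. *)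
Lemma vdW3_focus (T : finType) (s : nat) : exists N : nat,
  forall (f : nat -> T) (a : nat),
  (exists x d, [/\ (0 < d)%N, (x + d + d < a + N)%N, f x = f (x + d)%N
                 & f (x + d)%N = f (x + d + d)%N]) \/
  (exists e (ds : seq nat),
     [/\ size ds = s, (a <= e < a + N)%N, uniq [seq f (e - d)%N | d <- ds]
       & forall d, d \in ds ->
           [/\ (0 < d)%N, (a + d + d <= e)%N
             & f (e - d - d)%N = f (e - d)%N]]).
Proof.
elim: s => [|s [N IH]].
  exists 1%N => f a; right; exists a, [::].
  by split => //; rewrite leqnn addn1 ltnS leqnn.
set M := #|{ffun 'I_N -> T}|.
exists ((M.+1 * N).*2)%N => f a.
pose g (j : 'I_M.+1) : {ffun 'I_N -> T} :=
  [ffun i : 'I_N => f (a + j * N + i)%N].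
have [j1 [j2 [lt12 g12]]] : exists j1 j2 : 'I_M.+1, (j1 < j2)%N /\ g j1 = g j2.
  have /injectivePn [x [y nxy gxy]] : ~~ injectiveb g.
    apply/negP => /injectiveP /leq_card; rewrite card_ord -/M; lia.
  case: (ltngtP x y) => h; [by exists x, y|by exists y, x|].
  by case/eqP: nxy; apply: val_inj.
have le2 : (j2 <= M)%N by rewrite -ltnS.
pose D := ((j2 - j1) * N)%N; pose b := (a + j1 * N)%N.
have bD : (b + D = a + j2 * N)%N.
  by rewrite /b /D mulnBl; have := leq_mul (ltnW lt12) (leqnn N); lia.
have hN : (a + j2 * N + N <= a + M.+1 * N)%N.
  by rewrite mulSn; have := leq_mul le2 (leqnn N); lia.
have shift x : (b <= x < b + N)%N -> f (x + D)%N = f x.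
  move=> hx; have hi : (x - b < N)%N by lia.
  move/ffunP/(_ (Ordinal hi)): g12; rewrite !ffunE /= -bD -/b.
  have -> : (b + (x - b) = x)%N by lia.
  by have -> : (b + D + (x - b) = x + D)%N by lia.
case: (IH f b) => [[x [d [d0 xd e1 e2]]]|[e [ds [sz he un hds]]]].
  by left; exists x, d; split => //; lia.
case: (boolP (f e \in [seq f (e - d)%N | d <- ds])) => [/mapP[d dds fe]|nin].
  have [d0 bd fd] := hds _ dds.
  left; exists (e - d - d)%N, d; split => //.
  - lia.
  - by have -> : (e - d - d + d = e - d)%N by lia.
  - have -> : (e - d - d + d = e - d)%N by lia.
    by have -> : (e - d + d = e)%N by lia.
have N0 : (0 < N)%N by lia.
have D0 : (0 < D)%N by rewrite /D muln_gt0 subn_gt0 lt12.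
right; exists (e + D + D)%N, (D :: [seq (d + D)%N | d <- ds]); split.
- by rewrite /= size_map sz.
- by apply/andP; split; lia.
- have e1 : (e + D + D - D = e + D)%N by lia.
  have e2 : [seq f (e + D + D - d)%N | d <- [seq (d + D)%N | d <- ds]]
          = [seq f (e - d)%N | d <- ds].
    rewrite -map_comp; apply/eq_in_map => d /hds[d0 bd _] /=.
    have -> : (e + D + D - (d + D) = (e - d) + D)%N by lia.
    by rewrite shift //; lia.
  by rewrite /= e1 e2 un andbT shift.
- move=> d; rewrite inE => /predU1P[->|/mapP[d' d'ds ->]].
    split => //; first lia.
    have -> : (e + D + D - D - D = e)%N by lia.
    have -> : (e + D + D - D = e + D)%N by lia.
    by rewrite shift.
  have [d0 bd fd] := hds _ d'ds; split; [lia|lia|].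
  have -> : (e + D + D - (d' + D) - (d' + D) = e - d' - d')%N by lia.
  have -> : (e + D + D - (d' + D) = (e - d') + D)%N by lia.
  by rewrite shift //; lia.
Qed.

Lemma vdW3 (T : finType) : exists N : nat, forall f : nat -> T,
  exists x d, [/\ (0 < d)%N, (x + d + d < N)%N, f x = f (x + d)%N
                & f (x + d)%N = f (x + d + d)%N].
Proof.
have [N HN] := vdW3_focus T #|T|.+1; exists N => f.
case: (HN f 0%N) => [[x [d [d0 xd e1 e2]]]|[e [ds [sz _ un _]]]].
  by exists x, d.
have := max_card (mem [seq f (e - d)%N | d <- ds]).
by rewrite (card_uniqP un) size_map sz ltnn.
Qed.

(* For k = 0 there is no coloring of a nonempty interval; for k > 0 apply
   van der Waerden's theorem to the prefix sums modulo k. *)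
Lemma unavoidable_length_ex (k : nat) :
  exists n : nat, `[< unavoidable_length k n >].
Proof.
case: k => [|k]; first by exists 1%N; apply/asboolP => chi; case: (chi ord0).
have [N HN] := vdW3 'I_k.+1; exists N; apply/asboolP => chi.
set w := word_of chi.
have sw : size w = N by rewrite size_map size_enum_ord.
pose S i : int := \sum_(a <- take i w) a.
have Sr i : (0 <= (S i %% k.+1)%Z < k.+1)%R.
  by rewrite modz_ge0 // ltz_pmod.
pose f i : 'I_k.+1 := inord `|(S i %% k.+1)%Z|%N.
have fS i j : f i = f j -> (S i = S j %[mod k.+1])%Z.
  move=> /(congr1 val); have := Sr i; have := Sr j.
  by move=> hi hj /=; rewrite !inordK; lia.
have [x [d [d0 xd /fS e1 /fS e2]]] := HN f.
pose x1 := take d (drop x w); pose x2 := take d (drop (x + d) w).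
have t1 : take (x + d) w = take x w ++ x1 by rewrite takeD.
have t2 : take (x + d + d) w = take (x + d) w ++ x2 by rewrite takeD.
have s1 : size x1 = d by rewrite size_takel // size_drop sw; lia.
have s2 : size x2 = d by rewrite size_takel // size_drop sw; lia.
exists (x1 ++ x2).
  apply/infixP; exists (take x w), (drop (x + d + d) w).
  by rewrite catA catA -t1 -t2 cat_take_drop.
exists x1, x2; split => //.
- by move=> h; move: s1; rewrite h /=; lia.
- by move=> h; move: s2; rewrite h /=; lia.
- by rewrite s1 s2.
have S1 : \sum_(a <- x1) a = S (x + d)%N - S x.
  by rewrite /S t1 big_cat /= (addrC (\sum_(a <- _) a)) addrK.
have S2 : \sum_(a <- x2) a = S (x + d + d)%N - S (x + d)%N.
  by rewrite /S t2 big_cat /= (addrC (\sum_(a <- _) a)) addrK.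
have z1 : (\sum_(a <- x1) a = 0 %[mod k.+1])%Z.
  by rewrite S1 -modzDm -e1 modzDm subrr.
have z2 : (\sum_(a <- x2) a = 0 %[mod k.+1])%Z.
  by rewrite S2 -modzDm -e2 modzDm subrr.
by rewrite z1 z2.
Qed.

Definition L (k : nat) : nat := ex_minn (unavoidable_length_ex k).

(* Main.v *)
(** Passing to prefix sums, a word avoiding congruential 2-powers modulo [k] is
    a map [f] from [0, n] to Z/k such that [f x, f y, f z] is never a
    progression modulo [k] when [x, y, z] is a nontrivial one.  It suffices
    that [f] takes its values in a progression-free set of integers below [k/2]
    and has no monochromatic nontrivial progression.  The values are the
    integers with ternary digits 0 and 1.  The coloring is of Behrend type:
    write [x] with [D] digits in base [2h]; the color records which digits are
    at least [h], and the sum of the squares of the digits reduced modulo [h].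
    The first part rules out carries in [x + z = 2y], so strict convexity of
    the square forces [x = z].  With [h = 2^D] there are at most [2^(4D)]
    colors for [2^(D(D+1))] integers. *)
Require Import Defs.
From HB Require Import structures.
From mathcomp Require Import all_boot all_order all_algebra.
From mathcomp Require Import all_classical all_reals all_analysis.
From mathcomp Require Import zify ring.
Import Order.TTheory GRing.Theory Num.Theory.
Local Open Scope ring_scope.

(** * Integers with ternary digits 0 and 1 *)

Section Ternary.
Local Open Scope nat_scope.

Fixpoint ternary (l n : nat) : nat :=
  if l is l'.+1 then odd n + 3 * ternary l' n./2 else 0.

Lemma ternary_lt l n : (ternary l n).*2 < 3 ^ l.
Proof.
elim: l n => [|l IH] n //=; rewrite expnS.
by have := IH n./2; case: (odd n); lia.
Qed.

(** Both sides have ternary digits at most 2, so nothing carries. Each digit on the right is 0 or 2,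
    which makes the binary digits of [a] and [c] agree with those of [b]. *)
Lemma ternary_AP_free l a b c :
  a < 2 ^ l -> b < 2 ^ l -> c < 2 ^ l ->
  ternary l a + ternary l c = (ternary l b).*2 -> a = b /\ b = c.
Proof.
elim: l a b c => [|l IH] a b c; first by rewrite expn0; lia.
rewrite expnS /= => ha hb hc hE.
by have [] := IH a./2 b./2 c./2; lia.
Qed.

End Ternary.

(** * Convexity and the Behrend-type coloring *)

Lemma sqr_midpoint (x y z : nat) : (x + z = y.*2)%N ->
  ((y ^ 2).*2 <= x ^ 2 + z ^ 2)%N /\
  ((x ^ 2 + z ^ 2 = (y ^ 2).*2)%N -> x = z).
Proof.
wlog le_xz : x z / (x <= z)%N => [hw xyz|].
  case: (leqP x z) => [/hw|/ltnW/hw]; first exact.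
  by rewrite addnC [in (x ^ 2 + _)%N]addnC => /(_ xyz)[? h]; split => // /h.
(* In terms of the common difference, [x ^ 2 + z ^ 2] exceeds [(y ^ 2).*2] by exactly
   [2 * d ^ 2]. *)
move=> xyz; pose d := (y - x)%N.
have [-> ->] : y = (x + d)%N /\ z = (x + d + d)%N by rewrite /d; lia.
rewrite -!mulnn; split => [|E]; first by nia.
have /eqP : (d * d = 0)%N by nia.
by rewrite muln_eq0; lia.
Qed.

Lemma leq_add_eq (a b c d : nat) :
  (a <= b)%N -> (c <= d)%N -> (b + d = a + c)%N -> b = a /\ d = c.
Proof. lia. Qed.

Section Behrend.
Local Open Scope nat_scope.
Variable h : nat.
Hypothesis h_gt0 : 0 < h.

Fixpoint high_digits (D x : nat) : nat :=
  if D is D'.+1 then (h <= x %% h.*2) + (high_digits D' (x %/ h.*2)).*2 else 0.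

Fixpoint sum_sqr_digits (D x : nat) : nat :=
  if D is D'.+1 then (x %% h) ^ 2 + sum_sqr_digits D' (x %/ h.*2) else 0.

Lemma high_digits_lt D x : high_digits D x < 2 ^ D.
Proof.
elim: D x => [|D IH] x //=; rewrite expnS.
by have := IH (x %/ h.*2); case: (h <= _); lia.
Qed.

Lemma sum_sqr_digits_le D x : sum_sqr_digits D x <= D * h ^ 2.
Proof.
elim: D x => [|D IH] x //=.
by rewrite mulSn leq_add // leq_exp2r // ltnW // ltn_pmod.
Qed.

Lemma digit_split x :
  x = x %/ h.*2 * h.*2 + (h <= x %% h.*2) * h + x %% h.
Proof.
rewrite {1}(divn_eq x h.*2) -addnA; congr (_ + _).
have lt2h : x %% h.*2 < h.*2 by rewrite ltn_pmod // double_gt0.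
have -> : x %% h = x %% h.*2 %% h by rewrite modn_dvdm // -muln2 dvdn_mulr.
case: leqP => hx /=; last by rewrite mul0n add0n [RHS]modn_small.
by rewrite mul1n -[X in _ + X %% h](subnK hx) modnDr [X in _ + X]modn_small; lia.
Qed.

Lemma AP_digits x y z :
  x + z = y.*2 ->
  (h <= x %% h.*2) = (h <= y %% h.*2) -> (h <= z %% h.*2) = (h <= y %% h.*2) ->
  x %/ h.*2 + z %/ h.*2 = (y %/ h.*2).*2 /\ x %% h + z %% h = (y %% h).*2.
Proof.
move=> xyz ex ez; have dx := digit_split x; have dy := digit_split y.
have dz := digit_split z; rewrite ex in dx; rewrite ez in dz.
have := ltn_pmod x h_gt0; have := ltn_pmod y h_gt0; have := ltn_pmod z h_gt0.
move: (x %/ _) (y %/ _) (z %/ _) (x %% h) (y %% h) (z %% h) dx dy dz.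
move: (nat_of_bool _ * h) => e X Y Z x' y' z' dx dy dz lz ly lx.
(* The common high part [e] cancels; [x' + z'] and [y'.*2] are both below [h.*2], so the quotients
   cannot differ. *)
suff XYZ : X + Z = Y.*2.
  by split => //; have := congr1 (muln^~ h.*2) XYZ; lia.
by case: (ltngtP (X + Z) Y.*2) => // hXYZ; exfalso;
  have := leq_mul hXYZ (leqnn h.*2); lia.
Qed.

(** Midpoint convexity is summed over the digits. The inequality is carried through the induction
    because equality of the sums then forces equality at every digit. *)
Lemma behrend_convex D x y z :
  x < h.*2 ^ D -> z < h.*2 ^ D -> x + z = y.*2 ->
  high_digits D x = high_digits D y -> high_digits D z = high_digits D y ->
  (sum_sqr_digits D y).*2 <= sum_sqr_digits D x + sum_sqr_digits D z /\
  (sum_sqr_digits D x + sum_sqr_digits D z = (sum_sqr_digits D y).*2 -> x = z).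
Proof.
elim: D x y z => [|D IH] x y z /=; first by rewrite expn0; lia.
rewrite expnS mulnC => ltx ltz xyz ex ez.
have [ex1 ex2] : (h <= x %% h.*2) = (h <= y %% h.*2) /\
    high_digits D (x %/ h.*2) = high_digits D (y %/ h.*2).
  by move: ex; case: (h <= x %% _); case: (h <= y %% _); split => //; lia.
have [ez1 ez2] : (h <= z %% h.*2) = (h <= y %% h.*2) /\
    high_digits D (z %/ h.*2) = high_digits D (y %/ h.*2).
  by move: ez; case: (h <= z %% _); case: (h <= y %% _); split => //; lia.
have [XYZ xyz'] := AP_digits _ _ _ xyz ex1 ez1.
have h2_gt0 : 0 < h.*2 by rewrite double_gt0.
rewrite -ltn_divLR // in ltx; rewrite -ltn_divLR // in ltz.
have [le_sq eq_sq] := IH _ _ _ ltx ltz XYZ ex2 ez2.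
have dx := digit_split x; have dz := digit_split z.
rewrite ex1 in dx; rewrite ez1 in dz.
have [le_mid eq_mid] := sqr_midpoint _ _ _ xyz'.
split => [|E]; first by rewrite doubleD addnACA leq_add.
rewrite addnACA doubleD in E.
have [/eq_mid eqm /eq_sq eqXZ] := leq_add_eq _ _ _ _ le_mid le_sq E.
by rewrite dx dz eqXZ eqm.
Qed.

Definition behrend_color (D x : nat) : nat :=
  high_digits D x + 2 ^ D * sum_sqr_digits D x.

Lemma behrend_color_lt D x : behrend_color D x < 2 ^ D * (D * h ^ 2).+1.
Proof.
rewrite /behrend_color mulnS -addSn leq_add ?high_digits_lt //.
by rewrite leq_mul2l sum_sqr_digits_le orbT.
Qed.

Lemma behrend_color_inj D x y :
  behrend_color D x = behrend_color D y ->
  high_digits D x = high_digits D y /\ sum_sqr_digits D x = sum_sqr_digits D y.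
Proof.
rewrite /behrend_color => E; have D0 : 0 < 2 ^ D by rewrite expn_gt0.
have := congr1 (modn^~ (2 ^ D)) E; have := congr1 (divn^~ (2 ^ D)) E.
rewrite ![_ + 2 ^ D * _]addnC ![2 ^ D * _]mulnC /= !modnMDl !divnMDl //.
by rewrite !modn_small ?divn_small ?high_digits_lt // !addn0.
Qed.

Lemma behrend_color_AP_free D x y z :
  x < h.*2 ^ D -> z < h.*2 ^ D -> x + z = y.*2 ->
  behrend_color D x = behrend_color D y ->
  behrend_color D y = behrend_color D z -> x = z.
Proof.
move=> ltx ltz xyz /behrend_color_inj[px qx] /behrend_color_inj[pz qz].
have [_] := behrend_convex _ _ _ _ ltx ltz xyz px (esym pz).
by apply; rewrite qx -qz addnn.
Qed.

End Behrend.

(** * From progression-free maps to colorings *)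

Section PrefixSums.
Variables (f : nat -> nat) (k n : nat).
Hypothesis f_small : forall x, (x <= n)%N -> ((f x).*2 < k)%N.
Hypothesis f_AP_free : forall x y z, (x <= n)%N -> (y <= n)%N -> (z <= n)%N ->
  (x + z = y.*2)%N -> (f x + f z = (f y).*2)%N -> x = z.

Let k_gt0 : (0 < k)%N. Proof. exact: leq_ltn_trans (f_small 0 _). Qed.

(** Adding [k] keeps the truncated subtraction exact, since [f i < k]. *)
Let step (i : nat) : nat := ((f i.+1 + k - f i) %% k)%N.

Let step_lt i : (step i < k)%N. Proof. exact: ltn_pmod. Qed.

Let coloring (i : 'I_n) : 'I_k := Ordinal (step_lt i).

Let word_of_coloring : word_of coloring = mkseq (fun i => (step i)%:Z) n.
Proof. by rewrite /word_of /mkseq -val_enum_ord -map_comp. Qed.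

Let sum_prefix i : (i <= n)%N ->
  (\sum_(a <- take i (word_of coloring)) a = (f i)%:Z - (f 0%N)%:Z %[mod k%:Z])%Z.
Proof.
move=> le_in; rewrite word_of_coloring /mkseq -map_take take_iota (minn_idPl le_in).
rewrite big_map; elim: i le_in => [|i IH] le_in; first by rewrite big_nil subrr.
rewrite -addn1 iotaD big_cat /= big_seq1 add0n -[LHS]modzDm IH 1?ltnW // modzDm.
have f_le : (f i <= f i.+1 + k)%N by have := f_small i; lia.
have -> : (step i)%:Z = (((f i.+1)%:Z + k%:Z - (f i)%:Z) %% k%:Z)%Z.
  by rewrite /step -modz_nat -subzn.
rewrite modzDmr addn1 -[RHS](modzDr _ k%:Z); congr (_ %% _)%Z; ring.
Qed.

Lemma AP_free_avoidable : ~ unavoidable_length k n.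
Proof.
move=> /(_ coloring)[x /infixP[s [t w_eq]] [x1 [x2 [x_eq x10 _ sz12 sum12]]]].
have szw : size (word_of coloring) = n by rewrite size_map size_enum_ord.
set w := word_of coloring in w_eq szw.
set i := size s; set d := size x1.
have d_gt0 : (0 < d)%N by rewrite /d; case: x1 x10 {x_eq sz12 sum12 d}.
have sz : (i + d + d <= n)%N.
  by rewrite -szw w_eq x_eq !size_cat -sz12 -/d -/i; lia.
have sz1 : (i + d <= n)%N by apply: leq_trans sz; rewrite leq_addr.
have sz0 : (i <= n)%N by apply: leq_trans sz1; rewrite leq_addr.
have w0 : take i w = s by rewrite w_eq take_size_cat.
have w1 : take (i + d) w = s ++ x1.
  by rewrite w_eq x_eq -catA catA take_size_cat // size_cat.
have w2 : take (i + d + d) w = s ++ x1 ++ x2.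
  by rewrite w_eq x_eq catA take_size_cat // !size_cat -sz12 addnA.
have := sum_prefix i; have := sum_prefix (i + d)%N.
have := sum_prefix (i + d + d)%N; rewrite -/w w0 w1 w2 !big_cat /=.
move: sum12; set S := \sum_(a <- s) a; set S1 := \sum_(a <- x1) a.
set S2 := \sum_(a <- x2) a => sum12.
move=> /(_ sz) e2 /(_ sz1) e1 /(_ sz0) e0.
have dv : (k%:Z %| (f i)%:Z + (f (i + d + d)%N)%:Z - (f (i + d)%N).*2%:Z)%Z.
  move/eqP: sum12; move/eqP: e2; move/eqP: e1; move/eqP: e0.
  rewrite !eqz_mod_dvd => /dvdzP[q0 E0] /dvdzP[q1 E1] /dvdzP[q2 E2] /dvdzP[q3 E3].
  apply/dvdzP; exists (q1 *+ 2 - q0 - q2 - q3).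
  by rewrite !mulrBl mulrnAl -E0 -E1 -E2 -E3 -addnn PoszD; ring.
have := f_small _ sz0; have := f_small _ sz1; have := f_small _ sz.
(* Both [f i + f (i + d + d)] and [(f (i + d)).*2] lie in [[0, k)], so their difference is a
   multiple of [k] only when it is 0. *)
case/dvdzP: dv => q; case: (eqVneq q 0) => [->|q_neq0] Eq lt2 lt1 lt0.
  have xyz : (i + (i + d + d) = (i + d).*2)%N by rewrite -addnn; ring.
  have := f_AP_free _ _ _ sz0 sz1 sz xyz.
  move: Eq d_gt0; clear; lia.
by move: Eq lt0 lt1 lt2 q_neq0; clear; nia.
Qed.

End PrefixSums.

(** * Choice of parameters and the final estimate *)

Section LowerBound.
Local Open Scope nat_scope.

Lemma behrend_color_lt_pow D x : behrend_color (2 ^ D) D x < 2 ^ (4 * D).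
Proof.
apply: leq_trans (behrend_color_lt _ _ D x) _; first by rewrite expn_gt0.
have -> : 4 * D = D + (D + D * 2) by lia.
rewrite expnD leq_mul2l expn_eq0 /= expnD expnM.
apply: (@leq_trans (D.+1 * (2 ^ D) ^ 2)).
  by rewrite mulSn -add1n leq_add2r expn_gt0 expn_gt0.
by rewrite leq_mul2r ltn_expl ?orbT.
Qed.

(** Colors below [2 ^ (4 * D)] become integers with [4 * D] ternary digits, whose doubles are below
    [3 ^ (4 * D) = 81 ^ D]. *)
Lemma L_ge_pow (D k : nat) : 81 ^ D <= k -> 2 ^ (D.+1 * D) <= L k.
Proof.
move=> le_k; rewrite /L; case: ex_minnP => m /asboolP unavoid _.
rewrite leqNgt; apply/negP => lt_m.
have base : (2 ^ D).*2 ^ D = 2 ^ (D.+1 * D) by rewrite -mul2n -expnS -expnM.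
have pow_gt0 : 0 < 2 ^ D by rewrite expn_gt0.
apply: AP_free_avoidable unavoid => [x _|x y z lex ley lez xyz].
  apply: leq_trans (ternary_lt (4 * D) (behrend_color (2 ^ D) D x)) _.
  by rewrite expnM.
case/ternary_AP_free; try exact: behrend_color_lt_pow.
move=> eq_xy eq_yz.
by apply: behrend_color_AP_free eq_xy eq_yz; rewrite // base (leq_ltn_trans _ lt_m).
Qed.

End LowerBound.

Theorem theorem13 (R : realType) :
  exists2 c : R, 0 < c &
    exists K : nat, forall k : nat, (K <= k)%N ->
      (k%:R : R) `^ (c * ln k%:R) < (L k)%:R.
Proof.
have ln2_gt0 : 0 < ln 2 :> R by rewrite ln_gt0 // ltr1n.
have ln81_gt0 : 0 < ln 81 :> R by rewrite ln_gt0 // ltr1n.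
(* From [ln k < (D + 1) * ln 81], this constant gives [c * (ln k) ^ 2 < ln 2 * (D + 1) ^ 2 / 2].
   That is at most [ln 2 * (D + 1) * D] once [D >= 1], which [k >= 81] ensures. *)
have c_gt0 : 0 < ln 2 / (2 * ln 81 ^+ 2) :> R.
  by rewrite divr_gt0 // mulr_gt0 // exprn_gt0.
exists (ln 2 / (2 * ln 81 ^+ 2)) => //.
exists 81%N => k k_ge; pose D := trunc_log 81 k.
have k_gt0 : (0 < k)%N by apply: leq_trans k_ge.
have D_gt0 : (1 <= D)%N by apply: trunc_log_max.
have kR_ge1 : 1 <= k%:R :> R by rewrite ler1n.
apply: (@lt_le_trans _ _ (2 ^+ (D.+1 * D))); last first.
  by rewrite -natrX ler_nat L_ge_pow // trunc_logP.
have lnk_ge0 : 0 <= ln k%:R :> R by exact: ln_ge0.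
have lnk_lt : ln k%:R < ln 81 * D.+1%:R :> R.
  rewrite mulr_natr -lnXn ?ltr0n // ltr_ln ?posrE ?exprn_gt0 ?ltr0n //.
  by rewrite -natrX ltr_nat trunc_log_ltn.
rewrite -[2 ^+ _]lnK ?posrE ?exprn_gt0 // /powR pnatr_eq0 gtn_eqF // ltr_expR.
rewrite lnXn // -[ln 2 *+ _]mulr_natr natrM -mulrA.
have lnk_sq : ln k%:R * ln k%:R < (ln 81 * D.+1%:R) ^+ 2 :> R.
  by rewrite -expr2 ltrXn2r.
apply: (@lt_le_trans _ _ (ln 2 / (2 * ln 81 ^+ 2) * (ln 81 * D.+1%:R) ^+ 2)).
  by rewrite ltr_pM2l.
have -> : ln 2 / (2 * ln 81 ^+ 2) * (ln 81 * D.+1%:R) ^+ 2 =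
          ln 2 * (D.+1%:R * (D.+1%:R / 2)) :> R.
  by field; rewrite gt_eqF.
rewrite ler_pM2l // ler_pM2l ?ltr0n // ler_pdivrMr // -natrM ler_nat; lia.
Qed.
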